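(* Let $v$ be a valuation on a hyperfield $F$. Then $\mathcal O_v:=\{x\in F\mid v(x)\ge 0\}$ is a valuation hyperring of $F$, and $\mathcal M_v:=\{x\in F\mid v(x)>0\}$ is its unique maximal hyperideal.
   Context: A hyperoperation $+$ on a nonempty set $H$ assigns to each $(x,y)\in H\times H$ a nonempty subset $x+y\subseteq H$; for subsets, $A+B=\bigcup_{a\in A,b\in B}(a+b)$. A canonical hypergroup is $(H,+,0)$ with $+$ an associative and commutative hyperoperation such that for every $x$ there is a unique $-x$ with $0\in x+(-x)$, and $z\in x+y$ implies $y\in z-x:=z+(-x)$. A hyperring is $(R,+,\cdot,0)$ with $(R,+,0)$ a canonical hypergroup, $(R,\cdot)$ a commutative semigroup with $x\cdot 0=0$, and $x(y+z)=xy+xz$ as sets. A hyperfield is a hyperring $F$ with unity $1\neq 0$ such that $F^\times=F\setminus\{0\}$ is a group under multiplication. A subset $S$ of a hyperring $R$ is a subhyperring if it is multiplicatively closed and, with $a+_S b:=(a+b)\cap S$, it is itself a hyperring $(S,+_S,\cdot,0)$. It is a strict subhyperring if (it is nonempty and) $a-b\subseteq S$ and $ab\in S$ for all $a,b\in S$. A hyperideal of $R$ is a strict subhyperring $I$ with $rx\in I$ for all $r\in R$, $x\in I$. A hyperideal $I$ is maximal if $I\subsetneq R$ and every hyperideal $J$ with $I\subsetneq J$ equals $R$. A valuation hyperring of a hyperfield $F$ is a subhyperring $\mathcal O$ of $F$ such that for all $x\in F$, $x\in\mathcal O$ or $x^{-1}\in\mathcal O$ (for $x=0$ this means $0\in\mathcal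 O$). A valuation on $F$ is a map $v:F\to\Gamma\cup\{\infty\}$, $\Gamma$ a (linearly) ordered abelian group written additively, with: $v(a)=\infty$ iff $a=0$; $v(ab)=v(a)+v(b)$; $c\in a+b\Rightarrow v(c)\ge\min\{v(a),v(b)\}$. *)

(* Defs.v *)
From mathcomp Require Import all_boot all_order all_algebra.
From mathcomp Require Import boolp classical_sets.

Set Implicit Arguments.
Unset Strict Implicit.
Unset Printing Implicit Defensive.

Import Order.TTheory GRing.Theory.

Local Open Scope classical_set_scope.

Definition set_hadd (T : Type) (add : T -> T -> set T) (A B : set T) : set T :=
  \bigcup_(a in A) \bigcup_(b in B) add a b.

Definition is_canonical_hypergroup (T : Type) (add : T -> T -> set T)
    (zero : T) : Prop :=
  [/\ forall x y, add x y !=set0,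
      forall x y z, set_hadd add (add x y) [set z] = set_hadd add [set x] (add y z),
      forall x y, add x y = add y x
    & forall x, exists2 x' : T,
        unique (fun y => add x y zero) x' &
        forall y z, add x y z -> add z x' y].

Definition is_hyperring (T : Type) (add : T -> T -> set T) (mul : T -> T -> T)
    (zero : T) : Prop :=
  [/\ is_canonical_hypergroup add zero,
      forall x y z, mul x (mul y z) = mul (mul x y) z,
      forall x y, mul x y = mul y x,
      forall x, mul x zero = zero
    & forall x y z, [set mul x w | w in add y z] = add (mul x y) (mul x z)].

Record hyperring := Hyperring {
  hcarrier :> Type;
  hadd : hcarrier -> hcarrier -> set hcarrier;
  hmul : hcarrier -> hcarrier -> hcarrier;
  hzero : hcarrier;
  hyperringP : is_hyperring hadd hmul hzero
}.
Arguments hzero {_}.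

Lemma hopp_ex (R : hyperring) (x : R) :
  exists x' : R, unique (fun y => hadd x y hzero) x'.
Proof.
by case: (hyperringP R) => -[_ _ _ /(_ x)[x' x'P _]] _ _ _ _; exists x'.
Qed.

Definition hopp (R : hyperring) (x : R) : R := projT1 (cid (hopp_ex x)).

Definition hsub (R : hyperring) (x y : R) : set R := hadd x (hopp y).

(* [hinv hzero] is unconstrained. *)
Record hyperfield := Hyperfield {
  hfield_ring :> hyperring;
  hone : hfield_ring;
  hinv : hfield_ring -> hfield_ring;
  hmul1 : forall x : hfield_ring, hmul hone x = x;
  hone_neq0 : hone <> hzero;
  hmul_neq0 : forall x y : hfield_ring, x <> hzero -> y <> hzero -> hmul x y <> hzero;
  hinv_neq0 : forall x : hfield_ring, x <> hzero -> hinv x <> hzero;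
  hmulV : forall x : hfield_ring, x <> hzero -> hmul x (hinv x) = hone
}.

(* A set [S : set R] used as a type is the subtype [{x : R | x \in S}]. *)
Definition sub_hzero (R : hyperring) (S : set R) (S0 : S hzero) : S :=
  exist _ hzero (mem_set S0).

Definition sub_hadd (R : hyperring) (S : set R) (a b : S) : set S :=
  [set c : S | hadd (val a) (val b) (val c)].

Definition sub_hmul (R : hyperring) (S : set R)
    (SM : forall a b, S a -> S b -> S (hmul a b)) (a b : S) : S :=
  exist _ (hmul (val a) (val b))
    (mem_set (SM _ _ (set_mem (valP a)) (set_mem (valP b)))).

Record is_subhyperring (R : hyperring) (S : set R) : Prop := IsSubhyperring {
  subhr_zero : S hzero;
  subhr_mul : forall a b, S a -> S b -> S (hmul a b);
  subhr_hyperring :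
    is_hyperring (@sub_hadd R S) (sub_hmul subhr_mul) (sub_hzero subhr_zero)
}.

Definition sub_hyperring (R : hyperring) (S : set R) (hS : is_subhyperring S) :
  hyperring := Hyperring (subhr_hyperring hS).

Definition is_strict_subhyperring (R : hyperring) (S : set R) : Prop :=
  [/\ S !=set0,
      forall a b, S a -> S b -> hsub a b `<=` S
    & forall a b, S a -> S b -> S (hmul a b)].

Definition is_hyperideal (R : hyperring) (I : set R) : Prop :=
  is_strict_subhyperring I /\ forall r x, I x -> I (hmul r x).

Definition is_maximal_hyperideal (R : hyperring) (I : set R) : Prop :=
  [/\ is_hyperideal I,
      I `<` setT
    & forall J : set R, is_hyperideal J -> I `<` J -> J = setT].

(* A subset [I] of the ambient [R] that is a maximal hyperideal of [S]. *)
Definition is_maximal_hyperideal_of (R : hyperring) (S : set R)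
    (hS : is_subhyperring S) (I : set R) : Prop :=
  I `<=` S /\
  @is_maximal_hyperideal (sub_hyperring hS) [set x : S | I (val x)].

Record is_valuation_hyperring (F : hyperfield) (O : set F) : Prop :=
  IsValuationHyperring {
    valhr_sub :> is_subhyperring O;
    valhr_inv : forall x : F, O x \/ (x <> hzero /\ O (hinv x))
  }.

Record orderedGroup := OrderedGroup {
  ogroup :> porderZmodType;
  ogroup_total : forall x y : ogroup, (x <= y)%R || (y <= x)%R;
  ogroup_leD2r : forall z x y : ogroup, (x <= y)%R -> (x + z <= y + z)%R
}.

(* [option G] stands for [G] with infinity adjoined, [None] being infinity. *)
Section Infinity.
Variable G : orderedGroup.
Implicit Types x y : option G.

Definition add_infty x y : option G :=
  match x, y with
  | Some a, Some b => Some (a + b)%R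
  | _, _ => None
  end.

Definition le_infty x y : bool :=
  match x, y with
  | _, None => true
  | None, Some _ => false
  | Some a, Some b => (a <= b)%R
  end.

Definition lt_infty x y : bool := (x != y) && le_infty x y.

Definition min_infty x y : option G := if le_infty x y then x else y.

End Infinity.

Record valuation (F : hyperfield) (G : orderedGroup) := Valuation {
  vfun :> F -> option G;
  vfun_infty : forall a : F, vfun a = None <-> a = hzero;
  vfunM : forall a b : F, vfun (hmul a b) = add_infty (vfun a) (vfun b);
  vfunD : forall a b c : F, hadd a b c ->
    le_infty (min_infty (vfun a) (vfun b)) (vfun c)
}.

Definition valuation_ring (F : hyperfield) (G : orderedGroup)
    (v : valuation F G) : set F :=
  [set x | le_infty (Some 0%R) (v x)].

Definition valuation_ideal (F : hyperfield) (G : orderedGroup)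
    (v : valuation F G) : set F :=
  [set x | lt_infty (Some 0%R) (v x)].

(* Main.v *)
Require Import Defs.
From mathcomp Require Import all_boot all_order all_algebra.
From mathcomp Require Import boolp classical_sets.

(** Write O for the elements of value at least 0 and M for those of positive
value.  Everything rests on the fact that a valuation ignores signs.  In a
hyperring x(-y) = -(xy), because 0 lies in x(y + (-y)) = xy + x(-y) and
opposites are unique; hence (-1)(-1) = 1, so 2 v(-1) = v(1) = 0, and v(-1) = 0
since a linearly ordered group has no 2-torsion ([ogroup_double_eq0],
[val_hopp]).

Consequently O and M are closed under hyperdifferences.  For O this suffices:
a strict subhyperring S contains every sum a + b of two of its elements, so
that the hyperoperation cut down to S is the original one and the axioms
descend ([strict_subhyperring_sub]).  That O contains x or its inverse is
totality of the order applied to v(x) + v(x^-1) = 0.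

The elements of O outside M have value 0, so their inverses lie in O.  A
hyperideal of O that meets the complement of M thus contains 1 and is all of O
([hyperideal_with_unit]); M itself does not contain 1.  So M is a proper
hyperideal containing every proper hyperideal, which makes it the only maximal
one. *)

Set Implicit Arguments.
Unset Strict Implicit.
Unset Printing Implicit Defensive.

Import Order.TTheory GRing.Theory.

Local Open Scope classical_set_scope.

(** * Opposites in a hyperring *)

Lemma haddC (R : hyperring) (x y : R) : hadd x y = hadd y x.
Proof. by case: (hyperringP R) => -[]. Qed.

Lemma hmulC (R : hyperring) (x y : R) : hmul x y = hmul y x.
Proof. by case: (hyperringP R). Qed.

Lemma hmulr0 (R : hyperring) (x : R) : hmul x hzero = hzero.
Proof. by case: (hyperringP R). Qed.

Lemma hmulDr (R : hyperring) (x y z : R) :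
  [set hmul x w | w in hadd y z] = hadd (hmul x y) (hmul x z).
Proof. by case: (hyperringP R). Qed.

Lemma hadd_hopp (R : hyperring) (x : R) : hadd x (hopp x) hzero.
Proof. by rewrite /hopp; case: cid => x' []. Qed.

Lemma hopp_unique (R : hyperring) (x y : R) : hadd x y hzero -> hopp x = y.
Proof. by rewrite /hopp; case: cid => x' [] /= _; apply. Qed.

Lemma hoppK (R : hyperring) : involutive (@hopp R).
Proof. by move=> x; apply: hopp_unique; rewrite haddC; exact: hadd_hopp. Qed.

Lemma hadd_rev (R : hyperring) (x y z : R) :
  hadd x y z -> hadd z (hopp x) y.
Proof.
case: (hyperringP R) => -[_ _ _ /(_ x)[x' [x'P _] rev]] _ _ _ _.
by rewrite (hopp_unique x'P); exact: rev.
Qed.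

(** Reversibility turns 0 in (-x) + x into x in 0 + x. *)
Lemma hadd0 (R : hyperring) (x : R) : hadd hzero x x.
Proof. by have := hadd_rev (hadd_hopp (hopp x)); rewrite !hoppK. Qed.

Lemma hmulrN (R : hyperring) (x y : R) : hmul x (hopp y) = hopp (hmul x y).
Proof.
apply/esym/hopp_unique; rewrite -hmulDr; exists hzero; last exact: hmulr0.
exact: hadd_hopp.
Qed.

(** * Strict subhyperrings are subhyperrings *)

Section StrictSubhyperring.
Variables (R : hyperring) (S : set R).
Hypothesis hS : is_strict_subhyperring S.

Lemma strict_subhyperring0 : S hzero.
Proof.
by case: hS => -[a Sa] SB _; apply: (SB a a Sa Sa); exact: hadd_hopp.
Qed.

Lemma strict_subhyperringN a : S a -> S (hopp a).
Proof.
case: hS => _ SB _ Sa; apply: (SB _ _ strict_subhyperring0 Sa).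
exact: hadd0.
Qed.

Lemma strict_subhyperringD a b : S a -> S b -> hadd a b `<=` S.
Proof.
case: hS => _ SB _ Sa Sb; have := SB _ _ Sa (strict_subhyperringN Sb).
by rewrite /hsub hoppK.
Qed.

Lemma strict_subhyperringM a b : S a -> S b -> S (hmul a b).
Proof. by case: hS => _ _; apply. Qed.

(** The intermediate sums in associativity, the witness of nonemptiness, and the
opposites, all computed in R, already lie in S; so each axiom for S is the same
axiom for R. *)
Lemma strict_subhyperring_sub : is_subhyperring S.
Proof.
exists strict_subhyperring0 strict_subhyperringM.
have valS (x : S) : S (val x) by exact: set_mem (valP x).
have toS a : S a -> {x : S | val x = a}.
  by move=> Sa; exists (exist _ a (mem_set Sa)).
case: (hyperringP R) => -[addN0 addA addC _] mulA mulC mul0 mulD.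
split.
- split.
  + move=> x y; have [c xyc] := addN0 (val x) (val y).
    have [c' c'E] := toS _ (strict_subhyperringD (valS x) (valS y) xyc).
    by exists c'; rewrite /sub_hadd /= c'E.
  + move=> x y z; have {}addA := addA (val x) (val y) (val z).
    rewrite predeqE => c; split.
    * move=> [w xyw [_ -> wzc]].
      have : set_hadd (@hadd R) (hadd (val x) (val y)) [set val z] (val c).
        by exists (val w) => //; exists (val z).
      rewrite addA => -[_ -> [u yzu xuc]].
      have [u' u'E] := toS _ (strict_subhyperringD (valS y) (valS z) yzu).
      by exists x => //; exists u'; rewrite /sub_hadd /= u'E.
    * move=> [_ -> [w yzw xwc]].
      have : set_hadd (@hadd R) [set val x] (hadd (val y) (val z)) (val c).
        by exists (val x) => //; exists (val w).
      rewrite -addA => -[u xyu [_ -> uzc]].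
      have [u' u'E] := toS _ (strict_subhyperringD (valS x) (valS y) xyu).
      by exists u'; rewrite /sub_hadd /= ?u'E //; exists z; rewrite //= u'E.
  + by move=> x y; rewrite /sub_hadd addC.
  + move=> x; have [x' x'E] := toS _ (strict_subhyperringN (valS x)).
    exists x'; last by move=> y z; rewrite /sub_hadd /= x'E; exact: hadd_rev.
    split; first by rewrite /sub_hadd /= x'E; exact: hadd_hopp.
    by move=> y /hopp_unique xy; apply: val_inj; rewrite x'E -xy.
- by move=> x y z; apply: val_inj; exact: mulA.
- by move=> x y; apply: val_inj; exact: mulC.
- by move=> x; apply: val_inj; exact: mul0.
- move=> x y z; rewrite predeqE => c; split.
  + move=> [w yzw <-]; rewrite /sub_hadd /= -mulD.
    by exists (val w).
  + rewrite /sub_hadd /= -mulD => -[w yzw xwc].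
    have [w' w'E] := toS _ (strict_subhyperringD (valS y) (valS z) yzw).
    exists w'; first by rewrite /= w'E.
    by apply: val_inj; rewrite /= w'E.
Qed.

End StrictSubhyperring.

Lemma val_hopp_sub (R : hyperring) (S : set R) (hS : is_subhyperring S)
    (x : sub_hyperring hS) :
  val (hopp x : S) = hopp (val (x : S)).
Proof. by apply/esym/hopp_unique; exact: (hadd_hopp x). Qed.

(** * Hyperfields and hyperideals *)

Lemma hmulN1N1 (F : hyperfield) : hmul (hopp (hone F)) (hopp (hone F)) = hone F.
Proof. by rewrite hmulrN hmulC hmul1 hoppK. Qed.

Lemma hyperideal_with_unit (R : hyperring) (J : set R) (e x y : R) :
  (forall z, hmul e z = z) -> is_hyperideal J -> J x -> hmul y x = e ->
  J = setT.
Proof.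
move=> e1 [_ JM] Jx yx; apply/seteqP; split=> // z _.
by rewrite -(e1 z) hmulC; apply: (JM); rewrite -yx; exact: JM.
Qed.

(** * Values in an ordered group with infinity *)

Section OrderedGroup.
Variable G : orderedGroup.
Implicit Types x y : option G.

Local Notation nneg x := (le_infty (Some (0%R : G)) x).
Local Notation pos x := (lt_infty (Some (0%R : G)) x).

Lemma ogroup_double_eq0 (a : G) : (a + a = 0)%R -> (a = 0)%R.
Proof.
move=> aa; apply: le_anti.
by have /orP[] := ogroup_total a 0%R => a0; have := ogroup_leD2r a a0;
  rewrite aa add0r a0 => ->.
Qed.

Lemma nneg_add x y : nneg x -> nneg y -> nneg (add_infty x y).
Proof.
case: x y => [a|] [b|] //= a0 b0.
by have := ogroup_leD2r b a0; rewrite add0r; exact: le_trans.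
Qed.

Lemma pos_nneg x : pos x -> nneg x.
Proof. by case/andP. Qed.

Lemma nneg_pos_add x y : nneg x -> pos y -> pos (add_infty x y).
Proof.
move=> x0 y0; rewrite /lt_infty (nneg_add x0 (pos_nneg y0)) andbT.
case: x y x0 y0 => [a|] [b|] //= a0 /andP[bn0 b0].
apply: contra bn0 => /eqP[ab]; apply/eqP; congr Some; apply: le_anti.
apply/andP; split; first exact: b0.
by rewrite ab; have := ogroup_leD2r b a0; rewrite add0r.
Qed.

Lemma nneg_min x y z : nneg x -> nneg y ->
  le_infty (min_infty x y) z -> nneg z.
Proof.
have trans t : nneg t -> le_infty t z -> nneg z.
  by case: t z => [a|] [c|] //=; exact: le_trans.
by move=> x0 y0; rewrite /min_infty; case: ifP => _; exact: trans.
Qed.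

Lemma pos_min x y z : pos x -> pos y -> le_infty (min_infty x y) z -> pos z.
Proof.
move=> x0 y0 xyz.
rewrite /lt_infty (nneg_min (pos_nneg x0) (pos_nneg y0) xyz) andbT.
case: z xyz => [c|] // xyz; apply/eqP => -[c0]; move: xyz; rewrite -{}c0.
have nle t : pos t -> ~ le_infty t (Some (0%R : G)).
  case: t => [a|] // /andP[an0 a0] a0'.
  by case/eqP: an0; congr Some; apply: le_anti; apply/andP; split.
by rewrite /min_infty; case: ifP => _; exact: nle.
Qed.

End OrderedGroup.

(** * The valuation ring and its ideal *)

Section Valuation.
Variables (F : hyperfield) (G : orderedGroup) (v : valuation F G).

Local Notation O := (valuation_ring v).
Local Notation M := (valuation_ideal v).

Lemma val_finite (a : F) : a <> hzero -> exists g : G, v a = Some g.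
Proof.
move=> a0; case E: (v a) => [g|]; first by exists g.
by case: a0; exact/(vfun_infty v).
Qed.

Lemma val0 : v hzero = None.
Proof. exact/(vfun_infty v). Qed.

Lemma val1 : v (hone F) = Some 0%R.
Proof.
have [g vg] := val_finite (@hone_neq0 F).
have := vfunM v (hone F) (hone F); rewrite hmul1 vg => -[/esym gg].
by congr Some; apply: (addrI g); rewrite addr0.
Qed.

Lemma val_hopp (a : F) : v (hopp a) = v a.
Proof.
have vN1 : v (hopp (hone F)) = Some 0%R.
  have := vfunM v (hopp (hone F)) (hopp (hone F)); rewrite hmulN1N1 val1.
  case: (v _) => [g|] //= -[/esym gg].
  by congr Some; exact: ogroup_double_eq0.
have -> : hopp a = hmul a (hopp (hone F)) by rewrite hmulrN hmulC hmul1.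
by rewrite vfunM vN1; case: (v a) => [g|] //=; rewrite addr0.
Qed.

Lemma valuation_ring_strict : is_strict_subhyperring O.
Proof.
split.
- by exists hzero; rewrite /valuation_ring /= val0.
- move=> a b Oa Ob c /(vfunD v); rewrite val_hopp; exact: nneg_min.
- by move=> a b Oa Ob; rewrite /valuation_ring /= vfunM; exact: nneg_add.
Qed.

Lemma valuation_ring_hyperring : is_valuation_hyperring O.
Proof.
split; first exact: strict_subhyperring_sub valuation_ring_strict.
move=> x; have [->|x0] := pselect (x = hzero).
  by left; exact: strict_subhyperring0 valuation_ring_strict.
have [g vx] := val_finite x0; have [h vh] := val_finite (hinv_neq0 x0).
have := vfunM v x (hinv x); rewrite (hmulV x0) val1 vx vh => -[gh].
rewrite /valuation_ring /= vx vh /=.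
have /orP[g0|g0] := ogroup_total 0%R g; first by left.
by right; split=> //; have := ogroup_leD2r h g0; rewrite -gh add0r.
Qed.

Lemma valuation_ideal_sub : M `<=` O.
Proof. by move=> x; exact: pos_nneg. Qed.

Lemma valuation_ring_unit (x : F) : O x -> ~ M x ->
  O (hinv x) /\ hmul (hinv x) x = hone F.
Proof.
move=> Ox nMx.
have vx : v x = Some 0%R.
  apply/eqP; move/negP: nMx; rewrite /valuation_ideal /= /lt_infty.
  by rewrite negb_and [X in _ || ~~ X]Ox orbF negbK eq_sym.
have x0 : x <> hzero by move=> x0; move: vx; rewrite x0 val0.
split; last by rewrite hmulC hmulV.
have := vfunM v x (hinv x); rewrite (hmulV x0) val1 vx /valuation_ring /=.
by case: (v (hinv x)) => [h|] //= -[->]; rewrite add0r.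
Qed.

Section MaximalIdeal.
Variable hO : is_subhyperring O.

Local Notation A := (sub_hyperring hO).
Local Notation MO := [set x : O | M (val x)].

Lemma valuation_ideal_hyperideal : @is_hyperideal A MO.
Proof.
have OP (x : O) : O (val x) by exact: set_mem (valP x).
split; last first.
  move=> r x Mx; rewrite /= /valuation_ideal /= vfunM.
  exact: nneg_pos_add (OP r) Mx.
split.
- by exists (hzero : A); rewrite /= /valuation_ideal /= val0.
- move=> a b Ma Mb c /(vfunD v).
  rewrite val_hopp_sub val_hopp; exact: pos_min.
- move=> a b Ma Mb; rewrite /= /valuation_ideal /= vfunM.
  exact: nneg_pos_add (pos_nneg Ma) Mb.
Qed.

Lemma valuation_ideal_proper : MO `<` setT.
Proof.
have O1 : O (hone F) by rewrite /valuation_ring /= val1 /=.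
split=> // /(_ (exist _ (hone F) (mem_set O1)) I).
by rewrite /= /valuation_ideal /= val1 /lt_infty eqxx.
Qed.

(** Locality of O: whatever escapes the valuation ideal is invertible in O. *)
Lemma proper_hyperideal_sub (J : set A) :
  is_hyperideal J -> J <> setT -> J `<=` MO.
Proof.
move=> hJ JT x Jx; apply: contrapT => nMx; apply: JT.
have [Oi ix] := valuation_ring_unit (set_mem (valP (x : O))) nMx.
have O1 : O (hone F) by rewrite /valuation_ring /= val1 /=.
pose e : A := exist _ (hone F) (mem_set O1).
pose y : A := exist _ (hinv (val (x : O))) (mem_set Oi).
apply: (@hyperideal_with_unit A J e x y) => //.
  by move=> z; apply: val_inj; exact: hmul1.
by apply: val_inj.
Qed.

Lemma valuation_ideal_unique_maximal :
  unique (is_maximal_hyperideal_of hO) M.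
Proof.
split.
  split; first exact: valuation_ideal_sub.
  split; [exact: valuation_ideal_hyperideal|exact: valuation_ideal_proper|].
  move=> J hJ [_ nJM]; apply: contrapT => JT; apply: nJM.
  exact: proper_hyperideal_sub.
move=> N [NO [hN [_ nTN] maxN]].
have NM : [set x : O | N (val x)] `<=` MO.
  by apply: proper_hyperideal_sub => // NT; apply: nTN; rewrite NT.
have MN : MO `<=` [set x : O | N (val x)].
  apply: contrapT => nMN; case: valuation_ideal_proper => _; apply.
  by rewrite (maxN _ valuation_ideal_hyperideal (conj NM nMN)).
apply/seteqP; split=> x.
  by move=> Mx; exact: MN (exist _ x (mem_set (valuation_ideal_sub Mx))) Mx.
by move=> Nx; exact: NM (exist _ x (mem_set (NO _ Nx))) Nx.
Qed.

End MaximalIdeal.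
End Valuation.

Theorem proposition4p11 (F : hyperfield) (G : orderedGroup)
    (v : valuation F G) :
  exists hO : is_valuation_hyperring (valuation_ring v),
    unique (is_maximal_hyperideal_of hO) (valuation_ideal v).
Proof.
exists (valuation_ring_hyperring v).
exact: valuation_ideal_unique_maximal.
Qed.
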